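(* For every integer $m\ge4$ there exists a convex centrally symmetric $(2m)$-gon $P\subset\mathbb{R}^2$ that does not multi-tile by translations, i.e. there is no discrete multi-set $\Lambda$ in $\mathbb{R}^2$ such that $P+\Lambda$ multi-tiles.
   Context: A discrete multi-set $\Lambda$ in $\mathbb{R}^2$ is a discrete set each of whose points has a finite multiplicity in $\{1,2,\dots\}$. $P+\Lambda$ multi-tiles if there is a positive integer $k$ with $\sum_{\lambda\in\Lambda}\chi_P(x-\lambda)=k$ for almost every $x\in\mathbb{R}^2$ (sum counted with multiplicity), where $\chi_P$ is the indicator function of $P$. *)

(* Defs.v *)
From mathcomp Require Import all_boot all_order all_algebra.
From mathcomp Require Import all_classical all_reals all_analysis.

Set Implicit Arguments.
Unset Strict Implicit.
Unset Printing Implicit Defensive.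

Import Order.TTheory GRing.Theory Num.Theory.
Import numFieldNormedType.Exports.

Local Open Scope classical_set_scope.
Local Open Scope ring_scope.

(* [R^o] rather than [R], so that the product carries its R-module structure *)
Notation plane R := (R^o * R^o)%type.

Definition convex_hull (R : realType) (A : set (plane R)) : set (plane R) :=
  smallest (@convex_set R (plane R)) A.

(* A convex n-gon is the (closed, full) convex hull of n points in convex
   position; such points are automatically distinct and, for 2 < n, not
   collinear, and they are exactly the vertices of the polygon. *)
Definition convex_polygon (R : realType) (n : nat) (P : set (plane R)) : Prop :=
  (2 < n)%N /\
  exists v : 'I_n -> plane R,
    (forall i, ~ convex_hull (v @` [set~ i]) (v i)) /\
    P = convex_hull (range v).

Definition centrally_symmetric (R : realType) (P : set (plane R)) : Prop :=
  exists c : plane R, forall x, P x -> P (c *+ 2 - x).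

(* A multi-set is given by its multiplicity function; its underlying set
   consists of the points of nonzero multiplicity. *)
Definition msupport (R : realType) (L : plane R -> nat) : set (plane R) :=
  [set l | (0 < L l)%N].

(* Discreteness here is that of the subspace topology: every point is isolated,
   accumulation outside the underlying set is not excluded. *)
Definition discrete_multiset (R : realType) (L : plane R -> nat) : Prop :=
  msupport L `<=` isolated (msupport L).

Definition multi_tiles (R : realType) (P : set (plane R))
    (L : plane R -> nat) : Prop :=
  exists2 k : nat, (0 < k)%N &
    {ae (@lebesgue_measure R \x @lebesgue_measure R)%E, forall x : plane R,
      \esum_(l in msupport L) ((L l)%:R * \1_P (x - l))%:E
        = (k%:R)%:E :> \bar R}.

(* Main.v *)
(** The vertices of P are the partial sums of m edge vectors with increasing
    slopes, together with their reflections in the centre.  Comparing the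
    coverage at four points around an arbitrary point, displaced by [+-eps] along
    the edge vector [e] and by [+-eps^2] transversally, shows that the
    multiplicity [L] of a multi-tiling set satisfies
    [L x + L (x + e + t) = L (x + e) + L (x + t)], where [t] translates the edge
    to the opposite one.  As [L >= 0], each point of the support starts a full
    ray of the support in direction [e] or [t].  Choosing three edges such that
    every selection of one direction from each pair [{e, t}] is linearly
    independent over the rationals (this is where 4 <= m is needed), one gets of
    the order of N^3 support points within distance O(N), while a support that
    is locally bounded in the plane has only O(N^2) of them. *)

Require Import Defs.
From mathcomp Require Import all_boot all_order all_algebra.
From mathcomp Require Import all_classical all_reals all_analysis.
From mathcomp Require Import ring lra zify.
Import Order.TTheory GRing.Theory Num.Theory.
Import numFieldNormedType.Exports.
Local Open Scope classical_set_scope.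
Local Open Scope ring_scope.

Set Implicit Arguments.
Unset Strict Implicit.
Unset Printing Implicit Defensive.

(** * Counting points of the support *)

Definition near_box (R : realType) (c : plane R) (r : R) (x : plane R) : Prop :=
  `|x.1 - c.1| < r /\ `|x.2 - c.2| < r.

(** The bound [k] is uniform in the centre [c]; this is what makes counts in large boxes grow only
    quadratically. Duplicate-free lists stand for finite subsets. *)
Definition locally_at_most (R : realType) (S : set (plane R)) (r : R) (k : nat) : Prop :=
  forall (c : plane R) (X : seq (plane R)), uniq X ->
    (forall l, l \in X -> S l /\ near_box c r l) -> (size X <= k)%N.

Lemma size_le_fibers (T : eqType) (I : finType) (f : T -> I) (k : nat) (X : seq T) :
  (forall b, (size [seq x <- X | f x == b] <= k)%N) -> (size X <= k * #|I|)%N.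
Proof.
move=> h; rewrite -sum1_size (partition_big f xpredT)//=.
rewrite mulnC -sum_nat_const; apply: leq_sum => b _.
by rewrite -big_filter sum1_size.
Qed.

(** Each point is sent to the corner below and to the left of it in a grid of mesh [r]. A fibre of
    this map lies in a box of radius [r] about the grid point, and [W.*2.+1] indices per coordinate
    suffice. *)
Lemma box_count (R : realType) (S : set (plane R)) (r : R) (k W : nat)
    (c : plane R) (X : seq (plane R)) :
  0 < r -> locally_at_most S r k -> uniq X ->
  (forall l, l \in X -> S l /\ near_box c (r * W%:R) l) ->
  (size X <= k * (W.*2.+1 * W.*2.+1))%N.
Proof.
move=> r0 hS uX hX.
pose g (x : R) : 'I_(W.*2.+1) := inord (Num.trunc (x / r + W%:R)).
have gP x : `|x| < r * W%:R -> `|x - (((g x)%:R - W%:R) * r)| < r.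
  move=> hx; set y := x / r + W%:R.
  have xE : x = (y - W%:R) * r by rewrite /y addrK divfK ?gt_eqF.
  have := hx; rewrite ltr_norml {1 2}xE => /andP[h1 h2].
  have y0 : 0 <= y by nra.
  have yW : y < (W.*2.+1)%:R.
    by rewrite -addnn -natr1 natrD; nra.
  have := truncn_itv y0 => /andP[t1 t2].
  (* The index is in range, so [inord] does not fall back to its default value. *)
  have -> : (g x)%:R = (Num.trunc y)%:R :> R.
    rewrite /g inordK// -/y -(ltr_nat R); exact: le_lt_trans yW.
  rewrite {1}xE -mulrBl normrM (gtr0_norm r0) gtr_pMl//.
  by rewrite ltr_norml; move: t2; rewrite -natr1 => t2; apply/andP; split; lra.
pose f (l : plane R) := (g (l.1 - c.1), g (l.2 - c.2)).
have -> : (W.*2.+1 * W.*2.+1 = #|{: 'I_(W.*2.+1) * 'I_(W.*2.+1)}|)%N.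
  by rewrite card_prod !card_ord.
apply: (@size_le_fibers _ _ f k X) => -[b1 b2].
apply: (hS (c.1 + ((b1%:R - W%:R) * r), c.2 + ((b2%:R - W%:R) * r))).
  exact: filter_uniq.
move=> l; rewrite mem_filter => /andP[/eqP[<- <-]] /hX[Sl [l1 l2]].
by split=> //; split=> /=; rewrite opprD addrA; apply: gP.
Qed.

Lemma locally_finite (R : realType) (S : set (plane R)) (r : R) (k : nat)
    (c : plane R) (d : R) :
  0 < r -> locally_at_most S r k -> finite_set (S `&` near_box c d).
Proof.
move=> r0 hS; apply: contrapT => /infinite_set_fset infS.
pose W := (Num.trunc `|d / r|).+1.
have [B BS] := infS (k * (W.*2.+1 * W.*2.+1)).+1.
apply/negP; rewrite -leqNgt; apply: (@box_count R S r k W c) => // [|l lB].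
  exact: finmap.fset_uniq.
have [Sl [l1 l2]] := BS l lB; split=> //.
have dW : d <= r * W%:R.
  have /andP[_ h] := truncn_itv (normr_ge0 (d / r)).
  rewrite mulrC -ler_pdivrMr//; exact: le_trans (ler_norm _) (ltW h).
by split; apply: lt_le_trans dW.
Qed.

(** Following a [u0]-ray from [a], then a [u1]-ray from each point reached, then a [u2]-ray, yields
    a three-parameter family in [S], too large for its quadratic growth. The directions of the later
    rays may vary with the starting point, so independence is needed for every choice of
    booleans. *)
Lemma three_directions (R : realType) (S : set (plane R)) (r : R) (k : nat)
    (u0 u1 u2 : bool -> plane R) :
  0 < r -> locally_at_most S r k ->
  (forall a, S a -> exists b, forall n, S (a + u0 b *+ n)) ->
  (forall a, S a -> exists b, forall n, S (a + u1 b *+ n)) ->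
  (forall a, S a -> exists b, forall n, S (a + u2 b *+ n)) ->
  (forall b0 b1 b2 (n0 n1 n2 m0 m1 m2 : nat),
     u0 b0 *+ n0 + u1 b1 *+ n1 + u2 b2 *+ n2 = u0 b0 *+ m0 + u1 b1 *+ m1 + u2 b2 *+ m2 ->
     [/\ n0 = m0, n1 = m1 & n2 = m2]) ->
  S = set0.
Proof.
move=> r0 hS h0 h1 h2 free; apply: contrapT => /eqP/set0P[a Sa].
have [b0 Sb0] := h0 a Sa.
have pick (u : bool -> plane R) (h : forall a, S a -> exists b, forall n, S (a + u b *+ n)) :
    exists c : plane R -> bool, forall a, S a -> forall n, S (a + u (c a) *+ n).
  have /choice[c hc] : forall a, exists b, S a -> forall n, S (a + u b *+ n).
    by move=> x; have [/h[b hb]|nSx] := pselect (S x); [exists b|exists true].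
  by exists c.
have [c1 hc1] := pick _ h1; have [c2 hc2] := pick _ h2.
pose a1 (n0 : nat) := a + u0 b0 *+ n0.
pose a2 (n0 n1 : nat) := a1 n0 + u1 (c1 (a1 n0)) *+ n1.
pose a3 (n0 n1 n2 : nat) := a2 n0 n1 + u2 (c2 (a2 n0 n1)) *+ n2.
have Sa3 n0 n1 n2 : S (a3 n0 n1 n2) by apply/hc2/hc1/Sb0.
pose nm (x : plane R) : R := `|x.1 : R| + `|x.2 : R|.
have nm1 x : (`|x.1 : R| : R) <= nm x by rewrite -[leLHS]addr0; apply: lerD.
have nm2 x : (`|x.2 : R| : R) <= nm x by rewrite -[leLHS]add0r; apply: lerD.
pose M := nm (u0 b0) + (nm (u1 true) + nm (u1 false)) + (nm (u2 true) + nm (u2 false)) + 1.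
have nm_ge0 x : 0 <= nm x by exact: addr_ge0.
pose w := (Num.trunc (M / r)).+1.
have Mw : M < r * w%:R.
  have M0 : 0 <= M / r by apply: divr_ge0; [do !apply: addr_ge0|exact: ltW].
  have /andP[_ h] := truncn_itv M0.
  by rewrite mulrC -ltr_pdivrMr.
(* Chosen so that [N ^ 3] exceeds [4 * k * (2 * w + 1) ^ 2 * N ^ 2], the final upper bound. *)
pose N := (4 * k * (2 * w + 1) ^ 2).+1.
pose J : finType := ('I_N * 'I_N * 'I_N)%type.
pose F (j : J) := a3 j.1.1 j.1.2 j.2.
(* [F] alone may identify points reached along different directions. Recording the two chosen
   directions restores injectivity and costs a factor of 4. *)
pose G (j : J) := (F j, c1 (a1 j.1.1), c2 (a2 j.1.1 j.1.2)).
have injG : injective G.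
  move=> [[i0 i1] i2] [[j0 j1] j2] E.
  have e1 : c1 (a1 i0) = c1 (a1 j0) := congr1 (fun z => z.1.2) E.
  have e2 : c2 (a2 i0 i1) = c2 (a2 j0 j1) := congr1 (fun z => z.2) E.
  have : a3 i0 i1 i2 = a3 j0 j1 j2 := congr1 (fun z => z.1.1) E.
  rewrite /a3 -e2 /a2 -e1 /a1 -!addrA => /addrI.
  by rewrite !addrA => /free[/ord_inj -> /ord_inj -> /ord_inj ->].
pose X := undup [seq F j | j : J].
have sX : (size X <= k * ((w * N).*2.+1 * (w * N).*2.+1))%N.
  apply: (@box_count R S r k _ a) => //; first exact: undup_uniq.
  move=> l; rewrite mem_undup => /mapP[[[i0 i1] i2] _ ->].
  split; first exact: Sa3.
  have N0 : (0 : R) < N%:R by rewrite ltr0n.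
  have bnd (x0 x1 x2 m0 m1 m2 : R) (j0 j1 j2 : 'I_N) : `|x0| <= m0 -> `|x1| <= m1 -> `|x2| <= m2 ->
     m0 + m1 + m2 + 1 <= M -> `|x0 *+ j0 + x1 *+ j1 + x2 *+ j2| < r * (w * N)%:R.
    move=> e0 e1 e2 eM.
    have t (x m : R) (i : 'I_N) : `|x| <= m -> `|x *+ i| <= m * N%:R.
      move=> xm; rewrite normrMn -[_ *+ i]mulr_natr ler_pM// ler_nat; exact: ltnW.
    rewrite (le_lt_trans (ler_normD _ _))//.
    have h : `|x0 *+ j0 + x1 *+ j1| + `|x2 *+ j2| <= m0 * N%:R + m1 * N%:R + m2 * N%:R.
      by rewrite lerD ?t// (le_trans (ler_normD _ _))// lerD ?t.
    rewrite (le_lt_trans h)// natrM mulrA -!mulrDl ltr_pM2r//; lra.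
  have u1m b : nm (u1 b) <= nm (u1 true) + nm (u1 false).
    by case: b; rewrite ?lerDl ?lerDr.
  have u2m b : nm (u2 b) <= nm (u2 true) + nm (u2 false).
    by case: b; rewrite ?lerDl ?lerDr.
  have fstMn (x : plane R) n : (x *+ n).1 = x.1 *+ n by elim: n => //= n IH; rewrite !mulrS -IH.
  have sndMn (x : plane R) n : (x *+ n).2 = x.2 *+ n by elim: n => //= n IH; rewrite !mulrS -IH.
  rewrite /F /a3 /a2 /a1 /near_box /= !fstMn !sndMn.
  split.
  - set z := (X in `|X|).
    have -> : z = (u0 b0).1 *+ i0 + (u1 (c1 (a1 i0))).1 *+ i1 + (u2 (c2 (a2 i0 i1))).1 *+ i2.
      by rewrite /z /a2 /a1; ring.
    apply: (bnd _ _ _ (nm (u0 b0)) (nm (u1 true) + nm (u1 false))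
      (nm (u2 true) + nm (u2 false))) => //.
    + exact: le_trans (nm1 _) (u1m _).
    + exact: le_trans (nm1 _) (u2m _).
  - set z := (X in `|X|).
    have -> : z = (u0 b0).2 *+ i0 + (u1 (c1 (a1 i0))).2 *+ i1 + (u2 (c2 (a2 i0 i1))).2 *+ i2.
      by rewrite /z /a2 /a1; ring.
    by apply: bnd; [|exact: le_trans (u1m _)|exact: le_trans (u2m _)|]; rewrite ?lexx// lerDr.
have : (N ^ 3 <= 4 * size X)%N.
  have -> : (N ^ 3 = size [seq G j | j : J])%N.
    by rewrite size_map -cardT !card_prod !card_ord !expnS expn0 muln1 mulnA.
  have -> : (4 * size X = size [seq (x, b.1, b.2) | x <- X, b <- enum {: bool * bool}])%N.
    by rewrite size_allpairs -cardT card_prod card_bool mulnC.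
  apply: uniq_leq_size; first by rewrite map_inj_uniq ?enum_uniq.
  move=> _ /mapP[j _ ->]; apply/allpairsP.
  exists (F j, (c1 (a1 j.1.1), c2 (a2 j.1.1 j.1.2))); split=> //=.
    by rewrite mem_undup map_f ?mem_enum.
  by rewrite mem_enum.
have h : ((w * N).*2.+1 <= (2 * w + 1) * N)%N.
  by rewrite /N; nia.
have h2' : ((w * N).*2.+1 * (w * N).*2.+1 <= (2 * w + 1) ^ 2 * N ^ 2)%N.
  by rewrite -expnMn; apply: leq_mul.
have N0 : (0 < N)%N by [].
have e : (4 * size X <= (4 * k * (2 * w + 1) ^ 2) * N ^ 2)%N.
  by have := leq_mul (leqnn 4) (leq_trans sX (leq_mul (leqnn k) h2')); rewrite !mulnA.
move/leq_trans => /(_ _ e); rewrite expnS leq_pmul2r ?expn_gt0 ?N0//.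
by rewrite /N ltnn.
Qed.

(** * Coverage almost everywhere *)

Definition coverage (R : realType) (P : set (plane R)) (L : plane R -> nat)
    (x : plane R) : \bar R :=
  \esum_(l in msupport L) ((L l)%:R * \1_P (x - l))%:E.

(** An open box has measure [(2r)^2 > 0], hence is not contained in a null set. *)
Lemma ae_near_box (R : realType) (Q : plane R -> Prop) (c : plane R) (r : R) :
  0 < r ->
  {ae (@lebesgue_measure R \x @lebesgue_measure R)%E, forall x : plane R, Q x} ->
  exists2 x, near_box c r x & Q x.
Proof.
move=> r0 [N [mN N0 QN]]; apply: contrapT => nex.
pose A (a : R) : set R := `]a - r, a + r[%classic.
have mA a : measurable (A a) by exact: measurable_itv.
have AN : A c.1 `*` A c.2 `<=` N.
  move=> x []; rewrite /A /= !in_itv/= -!ltr_distlC => x1 x2; apply: QN => /= Qx.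
  by apply: nex; exists x => //; split; rewrite distrC.
have : ((@lebesgue_measure R \x @lebesgue_measure R) (A c.1 `*` A c.2) <= 0)%E.
  rewrite -N0; apply: le_measure => //; rewrite inE//.
  by apply: measurableX; exact: mA.
have leb a : @lebesgue_measure R (A a) = (r + r)%:E.
  rewrite lebesgue_measure_itv/= lte_fin ifT; last by lra.
  by rewrite -EFinD; congr (_%:E); lra.
suff -> : ((@lebesgue_measure R \x @lebesgue_measure R) (A c.1 `*` A c.2) =
    ((r + r) * (r + r))%:E)%E by rewrite lee_fin; apply/negP; rewrite -ltNge; nra.
rewrite product_measure1E; [|exact: mA|exact: mA]; rewrite EFinM.
by congr (_ * _)%E; apply: leb.
Qed.

Lemma coverage_size (R : realType) (P : set (plane R)) (L : plane R -> nat) (k : nat)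
    (x : plane R) (X : seq (plane R)) :
  coverage P L x = (k%:R)%:E -> uniq X ->
  (forall l, l \in X -> msupport L l /\ P (x - l)) -> (size X <= k)%N.
Proof.
move=> cx uX hX; rewrite -(ler_nat R) -lee_fin -cx.
apply: esum_ge; exists [set` X].
  by split=> [|l /= /hX[]//]; exact: finite_seq.
rewrite -fsbig_seq// sumEFin lee_fin -sum1_size natr_sum.
rewrite big_seq [leRHS]big_seq. apply: ler_sum => l /hX[Ll Pl].
by rewrite indicE mem_set// mulr1 ler_nat.
Qed.

(** Translates not containing [x] contribute zero, as do members of [X] of multiplicity zero, so the
    infinite sum reduces to one over [X]. *)
Lemma coverage_sum (R : realType) (P : set (plane R)) (L : plane R -> nat) (k : nat)
    (x : plane R) (X : seq (plane R)) :
  coverage P L x = (k%:R)%:E -> uniq X ->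
  (forall l, msupport L l -> P (x - l) -> l \in X) ->
  \sum_(l <- X) (L l)%:R * \1_P (x - l) = k%:R :> R.
Proof.
move=> cx uX hX; apply: EFin_inj; rewrite -cx -sumEFin fsbig_seq//.
rewrite -esum_fset; last first.
- by move=> l _; rewrite lee_fin mulr_ge0// indicE.
- exact: finite_seq.
rewrite /coverage esum_mkcond [RHS]esum_mkcond; apply: eq_esum => l _.
have [lX|lX] := boolP (l \in [set` X]); have [lS|lS] := boolP (l \in msupport L) => //.
- move: lS; rewrite notin_setE /= => /negP; rewrite -eqn0Ngt => /eqP ->.
  by rewrite mul0r.
- rewrite indicE memNset ?mulr0// => Pl; move: lX; rewrite notin_setE; apply.
  by apply: hX => //; rewrite inE in lS.
Qed.

(** For a point [x] of coverage [k] near [c + d], every [l] near [d] has [x - l] within [2r] of [c],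
    hence in [P]; so at most [k] such [l] occur. *)
Lemma coverage_locally_at_most (R : realType) (P : set (plane R)) (L : plane R -> nat) (k : nat)
    (c : plane R) (r : R) :
  0 < r -> near_box c (r + r) `<=` P ->
  {ae (@lebesgue_measure R \x @lebesgue_measure R)%E,
     forall x : plane R, coverage P L x = (k%:R)%:E} ->
  locally_at_most (msupport L) r k.
Proof.
move=> r0 cP tile d X uX hX.
have [x [x1 x2] cx] := ae_near_box (c + d) r0 tile.
apply: coverage_size cx uX _ => l /hX[Ll [l1 l2]]; split=> //; apply: cP.
have tri (a b u v : R) : `|a - (u + v)| < r -> `|b - v| < r -> `|a - b - u| < r + r.
  rewrite !ltr_norml => /andP[? ?] /andP[? ?]; apply/andP; split; lra.
by split; [exact: tri x1 l1|exact: tri x2 l2].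
Qed.

(** * The polygon *)

(** The linear form vanishing on the direction [(1, a)]: the vertical height above the line of slope
    [a] through the origin. *)
Definition hgt (R : realType) (a : R) (z : plane R) : R := z.2 - a * z.1.

(** The edge vectors are [(1, s i)], all of width one, so the abscissa of a vertex of the lower
    boundary is its index. *)
Definition chain (R : realType) (s : nat -> R) (k : nat) : plane R :=
  (k%:R, \sum_(i < k) s i).

(** An intersection of [m] strips: the lower line of strip [j] carries the edge from [chain s j] to
    [chain s j.+1], the upper line its reflection. *)
Definition zonogon (R : realType) (s : nat -> R) (m : nat) : set (plane R) :=
  [set z | forall j, (j < m)%N ->
     hgt (s j) (chain s j) <= hgt (s j) z <= hgt (s j) (chain s m - chain s j)].

Lemma hgtD (R : realType) (a : R) (x y : plane R) : hgt a (x + y) = hgt a x + hgt a y.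
Proof. by rewrite /hgt /=; ring. Qed.

Lemma hgtN (R : realType) (a : R) (x : plane R) : hgt a (- x) = - hgt a x.
Proof. by rewrite /hgt /=; ring. Qed.

Lemma hgt_conv (R : realType) (a t : R) (x y : plane R) :
  hgt a (t *: x + (1 - t) *: y) = t * hgt a x + (1 - t) * hgt a y.
Proof. by rewrite /hgt /= /GRing.scale/=; ring. Qed.

Lemma chain0 (R : realType) (s : nat -> R) : chain s 0 = 0.
Proof. by rewrite /chain big_ord0. Qed.

Lemma chainS (R : realType) (s : nat -> R) (k : nat) : chain s k.+1 = chain s k + (1, s k).
Proof. by rewrite /chain big_ord_recr /= -natr1. Qed.

Lemma hgt_chainS (R : realType) (s : nat -> R) (a : R) (k : nat) :
  hgt a (chain s k.+1) = hgt a (chain s k) + (s k - a).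
Proof. by rewrite chainS hgtD /hgt /= mulr1. Qed.

Lemma hgt_chain0 (R : realType) (s : nat -> R) (a : R) : hgt a (chain s 0) = 0.
Proof. by rewrite chain0 /hgt /= mulr0 subr0. Qed.

(** The step from [chain s k] to [chain s k.+1] changes the height by [s k - s j]. Thus heights fall
    up to index [j], stay level for one step, and rise afterwards. *)
Lemma hgt_chain_gt (R : realType) (s : nat -> R) (hs : {homo s : i j / (i < j)%N >-> i < j})
    (j k l : nat) : (j < k)%N -> (k < l)%N -> hgt (s j) (chain s k) < hgt (s j) (chain s l).
Proof.
move=> jk; elim: l => // l IH; rewrite ltnS leq_eqVlt hgt_chainS => /predU1P[<-|kl].
  by rewrite ltrDl subr_gt0 hs.
by rewrite (lt_trans (IH kl))// ltrDl subr_gt0 hs// (ltn_trans jk).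
Qed.

Lemma hgt_chain_lt (R : realType) (s : nat -> R) (hs : {homo s : i j / (i < j)%N >-> i < j})
    (j k l : nat) : (k < l)%N -> (l <= j)%N -> hgt (s j) (chain s l) < hgt (s j) (chain s k).
Proof.
move=> + lj; elim: l lj => // l IH lj; rewrite ltnS leq_eqVlt hgt_chainS => /predU1P[->|kl].
  by rewrite gtrDl subr_lt0 hs.
by rewrite (lt_trans _ (IH (ltnW lj) kl))// gtrDl subr_lt0 hs.
Qed.

Lemma hgt_chain_flat (R : realType) (s : nat -> R) (j : nat) :
  hgt (s j) (chain s j.+1) = hgt (s j) (chain s j).
Proof. by rewrite hgt_chainS subrr addr0. Qed.

Lemma hgt_chain_min_lt (R : realType) (s : nat -> R) (hs : {homo s : i j / (i < j)%N >-> i < j})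
    (j k : nat) : k != j -> k != j.+1 -> hgt (s j) (chain s j) < hgt (s j) (chain s k).
Proof.
move=> kj kj1; have [lt|] := ltnP k j; first exact: hgt_chain_lt.
rewrite leq_eqVlt eq_sym (negbTE kj)/= leq_eqVlt eq_sym (negbTE kj1)/= => gt.
by rewrite -hgt_chain_flat; apply: hgt_chain_gt.
Qed.

Lemma hgt_chain_min (R : realType) (s : nat -> R) (hs : {homo s : i j / (i < j)%N >-> i < j})
    (j k : nat) : hgt (s j) (chain s j) <= hgt (s j) (chain s k).
Proof.
have [->//|kj] := eqVneq k j.
have [->|kj1] := eqVneq k j.+1.
  by rewrite hgt_chain_flat.
exact/ltW/hgt_chain_min_lt.
Qed.

(** This places the lower chain under every upper edge. For [k <= j] the height of [chain s k] is at
    most 0 and that of [chain s j] is minimal; for [k > j] the heights increase up to index [m]. *)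
Lemma hgt_chain_add (R : realType) (s : nat -> R) (hs : {homo s : i j / (i < j)%N >-> i < j})
    (m j k : nat) : (j < m)%N -> (k <= m)%N ->
  hgt (s j) (chain s k) + hgt (s j) (chain s j) <= hgt (s j) (chain s m).
Proof.
move=> jm km.
have j0 : hgt (s j) (chain s j) <= 0 by rewrite -(hgt_chain0 s (s j)) hgt_chain_min.
have [kj|jk] := leqP k j.
  have : hgt (s j) (chain s k) <= 0.
    case: k kj {km} => [|k] kj; first by rewrite hgt_chain0.
    by rewrite -(hgt_chain0 s (s j)) ltW// hgt_chain_lt.
  by have := hgt_chain_min hs j m; lra.
have : hgt (s j) (chain s k) <= hgt (s j) (chain s m).
  by move: km; rewrite leq_eqVlt => /predU1P[->//|km]; rewrite ltW// hgt_chain_gt.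
by lra.
Qed.

Lemma hgt_chain_add_lt (R : realType) (s : nat -> R) (hs : {homo s : i j / (i < j)%N >-> i < j})
    (m j k : nat) : (0 < j)%N -> (j < m)%N -> (0 < k)%N -> (k <= m)%N ->
  hgt (s j) (chain s k) + hgt (s j) (chain s j) < hgt (s j) (chain s m).
Proof.
move=> j0 jm k0 km.
have j0' : hgt (s j) (chain s j) < 0 by rewrite -(hgt_chain0 s (s j)) hgt_chain_lt.
have [kj|jk] := leqP k j.
  have : hgt (s j) (chain s k) < 0 by rewrite -(hgt_chain0 s (s j)) hgt_chain_lt.
  by have := hgt_chain_min hs j m; lra.
have : hgt (s j) (chain s k) <= hgt (s j) (chain s m).
  by move: km; rewrite leq_eqVlt => /predU1P[->//|km]; rewrite ltW// hgt_chain_gt.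
by lra.
Qed.

Lemma zonogon_sym (R : realType) (s : nat -> R) (m : nat) (z : plane R) :
  zonogon s m z -> zonogon s m (chain s m - z).
Proof.
by move=> Pz j /Pz/andP[h1 h2]; move: h1 h2; rewrite !hgtD !hgtN => h1 h2; apply/andP; split; lra.
Qed.

Lemma zonogon_chain (R : realType) (s : nat -> R) (hs : {homo s : i j / (i < j)%N >-> i < j})
    (m k : nat) : (k <= m)%N -> zonogon s m (chain s k).
Proof.
move=> km j jm; rewrite hgt_chain_min//= hgtD hgtN.
by have := hgt_chain_add hs jm km; lra.
Qed.

(** The first and the last strip already suffice: they meet in a parallelogram whose leftmost and
    rightmost corners are the origin and [chain s m]. *)
Lemma zonogon_fst (R : realType) (s : nat -> R) (hs : {homo s : i j / (i < j)%N >-> i < j})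
    (m : nat) (z : plane R) : (1 < m)%N -> zonogon s m z -> 0 <= z.1 <= m%:R.
Proof.
case: m => // m m1 Pz.
have s0m : s 0 < s m by apply: hs.
have /andP[l1 l2] := Pz 0%N isT; have /andP[u1 u2] := Pz m (ltnSn _).
rewrite hgt_chain0 in l1.
rewrite hgtD hgtN hgt_chain_flat subrr in u2.
have {}l2 : hgt (s 0) z <= hgt (s 0) (chain s m.+1).
  by move: l2; rewrite hgtD hgtN hgt_chain0 subr0.
rewrite -hgt_chain_flat in u1.
move: l1 l2 u1 u2; rewrite /hgt /=; set S := \sum_(i < _) _.
set x : R := z.1; set y : R := z.2; set M : R := m.+1%:R => l1 l2 u1 u2.
by apply/andP; split; rewrite leNgt; apply/negP => h; nra.
Qed.

Lemma convex_hullP (R : realType) (A : set (plane R)) (x y : plane R) (t : R) :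
  0 <= t <= 1 -> convex_hull A x -> convex_hull A y ->
  convex_hull A (t *: x + (1 - t) *: y).
Proof.
move=> t01 Ax Ay M [cM AM].
have := cM x y (Itv01 (proj1 (andP t01)) (proj2 (andP t01))).
by rewrite !inE; apply; [exact: Ax|exact: Ay].
Qed.

Lemma convex_hull_min (R : realType) (A C : set (plane R)) :
  (forall (x y : plane R) (t : R), 0 <= t <= 1 -> C x -> C y -> C (t *: x + (1 - t) *: y)) ->
  A `<=` C -> convex_hull A `<=` C.
Proof.
move=> hC; apply: smallest_sub => x y t; rewrite !inE => Cx Cy.
by apply: hC => //; rewrite ge0/=.
Qed.

(** Counterclockwise order: the lower chain from left to right, then its reflection from right to
    left. *)
Definition vertex (R : realType) (s : nat -> R) (m : nat) (i : 'I_(2 * m)) : plane R :=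
  if (i < m)%N then chain s i else chain s m - chain s (i - m).

Lemma vertex_lower (R : realType) (s : nat -> R) (m k : nat) :
  (k <= m)%N -> (0 < m)%N -> range (vertex s (m := m)) (chain s k).
Proof.
move=> km m0; have k2 : (k < 2 * m)%N by lia.
exists (Ordinal k2) => //; rewrite /vertex /=; case: ltnP => // mk.
have -> : k = m by lia.
by rewrite subnn chain0 subr0.
Qed.

Lemma vertex_upper (R : realType) (s : nat -> R) (m k : nat) :
  (k <= m)%N -> (0 < m)%N -> range (vertex s (m := m)) (chain s m - chain s k).
Proof.
rewrite leq_eqVlt => /predU1P[->|km] m0.
  by rewrite subrr -(chain0 s); apply: vertex_lower.
have k2 : (m + k < 2 * m)%N by lia.
by exists (Ordinal k2) => //; rewrite /vertex /= ltnNge leq_addr/= addKn.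
Qed.

Lemma plane_eq (R : realType) (x y : plane R) : x.1 = y.1 -> x.2 = y.2 -> x = y.
Proof. by case: x y => [? ?] [? ?] /= -> ->. Qed.

(** The vertical line through [z] meets a lower edge in [p] and an upper edge in [q]; [z] lies
    between them, and each is a convex combination of two vertices. *)
Lemma zonogon_sub_hull (R : realType) (s : nat -> R) (hs : {homo s : i j / (i < j)%N >-> i < j})
    (m : nat) : (1 < m)%N -> zonogon s m `<=` convex_hull (range (vertex s (m := m))).
Proof.
move=> m1 z Pz; have /andP[z0 zm] := zonogon_fst hs m1 Pz.
have [k km /andP[kz zk]] : exists2 k, (k < m)%N & k%:R <= (z.1 : R) <= k.+1%:R.
  have /andP[t1 t2] := truncn_itv z0.
  move: zm; rewrite le_eqVlt => /predU1P[->|zm].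
    by exists m.-1; rewrite ?prednK ?ler_nat ?leqnn ?leq_pred //; lia.
  exists (Num.trunc (z.1 : R)); last by rewrite t1 ltW.
  by rewrite -(ltr_nat R); apply: le_lt_trans zm.
pose t : R := k.+1%:R - z.1.
have t01 : 0 <= t <= 1 by rewrite /t; move: kz zk; rewrite -natr1 => *; apply/andP; split; lra.
have m0 : (0 < m)%N by exact: ltnW.
have Vl j : (j <= m)%N -> convex_hull (range (vertex s (m := m))) (chain s j).
  by move=> jm; apply: sub_gen_smallest; apply: vertex_lower.
have Vu j : (j <= m)%N -> convex_hull (range (vertex s (m := m))) (chain s m - chain s j).
  by move=> jm; apply: sub_gen_smallest; apply: vertex_upper.
have := convex_hullP t01 (Vl k (ltnW km)) (Vl k.+1 km).
set p := (X in convex_hull _ X) => hp.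
(* The upper edge over the abscissas from [k] to [k.+1] is the reflection of lower edge number
   [m - k.+1]. *)
have := convex_hullP t01 (Vu (m - k)%N (leq_subr _ _)) (Vu (m - k.+1)%N (leq_subr _ _)).
set q := (X in convex_hull _ X) => hq.
have p1 : p.1 = z.1 by rewrite /p /= /GRing.scale/= /t -natr1; ring.
have q1 : q.1 = z.1.
  rewrite /q /= /GRing.scale/= !natrB ?(ltnW km)// /t -natr1; ring.
have pz : p.2 <= z.2.
  have /andP[+ _] := Pz k km.
  have <- : hgt (s k) p = hgt (s k) (chain s k).
    by rewrite /p hgt_conv hgt_chain_flat; ring.
  by rewrite /hgt p1; lra.
have zq : z.2 <= q.2.
  have jm : (m - k.+1 < m)%N by lia.
  have /andP[_] := Pz _ jm.
  have <- : hgt (s (m - k.+1)%N) q = hgt (s (m - k.+1)%N) (chain s m - chain s (m - k.+1)%N).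
    rewrite /q hgt_conv !hgtD !hgtN.
    have -> : (m - k = (m - k.+1).+1)%N by lia.
    by rewrite hgt_chain_flat; ring.
  by rewrite /hgt q1; lra.
have [pq|pq] := eqVneq (p.2 : R) q.2.
  suff -> : z = p by [].
  by apply: plane_eq => //; apply/eqP; rewrite eq_le pz pq zq.
have {}pq : 0 < (q.2 : R) - p.2 by rewrite subr_gt0 lt_neqAle pq (le_trans pz).
pose w : R := (q.2 - z.2) / (q.2 - p.2).
have w01 : 0 <= w <= 1.
  rewrite /w divr_ge0 ?(ltW pq) ?subr_ge0//= ler_pdivrMr// mul1r; exact: lerB.
suff -> : z = w *: p + (1 - w) *: q by exact: convex_hullP.
have wE : w * (q.2 - p.2) = q.2 - z.2 by rewrite /w divfK// gt_eqF.
have conv1 (c : R) : c = w * c + (1 - w) * c by ring.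
apply: plane_eq; first by rewrite [LHS]conv1 -{1}p1 -q1.
suff : z.2 = w * p.2 + (1 - w) * q.2 :> R by [].
have -> : w * p.2 + (1 - w) * q.2 = q.2 - w * (q.2 - p.2) by ring.
by rewrite wE; ring.
Qed.

Lemma zonogon_hull (R : realType) (s : nat -> R) (hs : {homo s : i j / (i < j)%N >-> i < j})
    (m : nat) : (1 < m)%N -> zonogon s m = convex_hull (range (vertex s (m := m))).
Proof.
move=> m1; apply/seteqP; split; first exact: zonogon_sub_hull.
apply: convex_hull_min.
  move=> x y t /andP[t0 t1] Px Py j jm; rewrite hgt_conv.
  have /andP[x1 x2] := Px j jm; have /andP[y1 y2] := Py j jm.
  by apply/andP; split; nra.
move=> _ [i _ <-]; rewrite /vertex; case: ltnP => im.
  by apply: zonogon_chain => //; apply: ltnW.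
apply: zonogon_sym; apply: zonogon_chain => //.
by case: i im => /= i; lia.
Qed.

(** At the leftmost vertex [f] is the abscissa. At any other vertex of the lower chain it is the sum
    of the heights over the two adjacent edges, each minimal there and both minimal only there. *)
Lemma chain_separated (R : realType) (s : nat -> R) (hs : {homo s : i j / (i < j)%N >-> i < j})
    (m k : nat) : (k < m)%N ->
  exists f : plane R -> R, [/\
    forall x y t, f (t *: x + (1 - t) *: y) = t * f x + (1 - t) * f y,
    forall x y, f (x - y) = f x - f y,
    forall j, (j <= m)%N -> j != k -> f (chain s k) < f (chain s j) &
    forall j, (j < m)%N -> f (chain s k) < f (chain s m - chain s j)].
Proof.
case: k => [|k] km.
  exists (fun z => z.1); split=> //.
  - by move=> j _ j0; rewrite /chain /= ltr_nat lt0n.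
  - by move=> j jm; rewrite /chain /= subr_gt0 ltr_nat.
exists (fun z => hgt (s k) z + hgt (s k.+1) z); split.
- by move=> x y t; rewrite !hgt_conv; ring.
- by move=> x y; rewrite !hgtD !hgtN; ring.
- move=> j jm jk; rewrite hgt_chain_flat.
  have [->|jk2] := eqVneq j k.+2.
    by rewrite hgt_chain_flat ltrD2r -hgt_chain_flat hgt_chain_gt.
  by rewrite ler_ltD ?hgt_chain_min// hgt_chain_min_lt.
- move=> [|j] jm.
    rewrite chain0 subr0 hgt_chain_flat.
    have [mk|mk] := eqVneq m k.+2.
      by rewrite mk hgt_chain_flat ltrD2r -hgt_chain_flat hgt_chain_gt.
    by rewrite ler_ltD ?hgt_chain_min// hgt_chain_min_lt// gtn_eqF.
  rewrite !hgtD !hgtN hgt_chain_flat.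
  have := hgt_chain_add hs (ltnW km) (ltnW jm).
  by have := @hgt_chain_add_lt _ s hs m k.+1 j.+1 isT km isT (ltnW jm); lra.
Qed.

Lemma zonogon_polygon (R : realType) (s : nat -> R) (hs : {homo s : i j / (i < j)%N >-> i < j})
    (m : nat) : (1 < m)%N -> convex_polygon (2 * m) (zonogon s m).
Proof.
move=> m1; split; first by lia.
exists (vertex s (m := m)); split; last exact: zonogon_hull.
(* Open half-planes are convex, so a strict inequality passes from the other vertices to their
   hull. *)
have half (f : plane R -> R) (c : R) (A : set (plane R)) z :
    (forall x y t, f (t *: x + (1 - t) *: y) = t * f x + (1 - t) * f y) ->
    A `<=` [set z | c < f z] -> convex_hull A z -> c < f z.
  move=> fl Af; apply: (@convex_hull_min _ _ [set z | c < f z]) => //.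
  move=> x y t /andP[t0 t1] /= cx cy; rewrite fl.
  have [->|t0'] := eqVneq t 0; first by rewrite mul0r add0r subr0 mul1r.
  have : 0 < t by rewrite lt0r t0' t0.
  by move=> {}t0; nra.
move=> i; case: (ltnP i m) => im.
  have [f [fl fB f1 f2]] := chain_separated hs im.
  move=> h; suff : f (vertex s i) < f (vertex s i) by rewrite ltxx.
  apply: half h => // _ [j ji <-] /=; rewrite [X in f X < _]/vertex im /vertex.
  case: ltnP => jm; first by apply: f1; [exact: ltnW|]; apply/eqP => /val_inj.
  by apply: f2; case: j {ji} jm => /= j; lia.
have im' : (i - m < m)%N by case: i im => /= i; lia.
have [f [fl fB f1 f2]] := chain_separated hs im'.
(* The reflection in the centre turns a strict minimum of [f] into a strict maximum, hence the
   sign. *)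
move=> h; suff : - f (vertex s i) < - f (vertex s i) by rewrite ltxx.
apply: (half (fun z => - f z)) h => [x y t|_ [j ji <-] /=].
  by rewrite fl; ring.
have -> : vertex s i = chain s m - chain s (i - m) by rewrite /vertex ltnNge im.
rewrite fB /vertex; case: ltnP => jm.
  by have := f2 j jm; rewrite fB; lra.
have /f1 : (j - m <= m)%N by case: j {ji} jm => /= j; lia.
have jim : (j - m)%N != (i - m)%N.
  apply/eqP => e; apply: ji; apply: val_inj => /=.
  by rewrite -(subnK jm) e subnK.
by rewrite fB => /(_ jim); lra.
Qed.

Lemma zonogon_centrally_symmetric (R : realType) (s : nat -> R) (m : nat) :
  centrally_symmetric (zonogon s m).
Proof.
exists (2^-1 *: chain s m) => x /zonogon_sym.
suff -> : (2^-1 *: chain s m) *+ 2 = chain s m by [].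
by rewrite scalerMnl -mulr_natr mulVf ?scale1r// pnatr_eq0.
Qed.

(** * Local structure at the vertices *)

(* The sign of c + e d + e^2 tau for small e > 0. *)
Definition lexpos (R : realType) (c d tau : R) : bool :=
  (0 < c) || ((c == 0) && ((0 < d) || ((d == 0) && (0 < tau)))).

(** A nonzero [tau] rules out a tie, so a failing sign condition is strictly reversed. *)
Lemma lexposN (R : realType) (c d tau : R) :
  tau != 0 -> ~~ lexpos c d tau -> lexpos (- c) (- d) (- tau).
Proof.
by rewrite /lexpos !oppr_gt0 !oppr_eq0; case: (ltgtP 0 c); case: (ltgtP 0 d); case: (ltgtP 0 tau).
Qed.

(** The first nonzero term among [c], [e * d], [e ^+ 2 * tau] dominates all later ones and any error
    of order [e ^+ 3], uniformly in [g]. *)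
Lemma lexpos_near (R : realType) (c d tau M : R) : 0 <= M -> lexpos c d tau ->
  \forall e \near 0^'+, forall g, `|g| <= M * e ^+ 3 -> 0 < c + e * d + e ^+ 2 * tau + g.
Proof.
move=> M0 /orP lex.
suff [e0 e0_gt0 h] : exists2 e0, 0 < e0 & forall e, 0 < e -> e < e0 ->
    forall g, `|g| <= M * e ^+ 3 -> 0 < c + e * d + e ^+ 2 * tau + g.
  near=> e; apply: h; [by near: e; exact: nbhs_right_gt|by near: e; exact: nbhs_right_lt].
have key (a K : R) : 0 < a -> 0 <= K ->
    exists2 e0, 0 < e0 <= 1 & forall e, 0 < e -> e < e0 -> e * K < a.
  move=> a0 K0; exists (Num.min 1 (a / (K + 1))).
    by rewrite ge_min lexx lt_min ltr01 divr_gt0// ltr_wpDl.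
  move=> e e0; rewrite lt_min => /andP[_]; rewrite ltr_pdivlMr ?ltr_wpDl// => h.
  by apply: le_lt_trans h; rewrite ler_pM2l// lerDl.
have K0 : 0 <= `|d| + `|tau| + M by rewrite !addr_ge0.
have /andP[nd1 nd2] : - `|d| <= d <= `|d| by rewrite -ler_norml.
have /andP[nt1 nt2] : - `|tau| <= tau <= `|tau| by rewrite -ler_norml.
have nd := normr_ge0 d; have nt := normr_ge0 tau.
case: lex => [c0|/andP[/eqP-> /orP[d0|/andP[/eqP-> t0]]]].
- have [e0 /andP[e00 e01] h] := key _ _ c0 K0; exists e0 => // e ep /[dup] /(h e ep) hK ee g.
  rewrite ler_norml => /andP[g1 _].
  have e1 : e < 1 by lra.
  have e2 : e ^+ 2 <= e by rewrite expr2; nra.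
  have e3 : e ^+ 3 <= e by rewrite exprS; nra.
  have : M * e ^+ 3 <= M * e by rewrite ler_wpM2l.
  have : e ^+ 2 * `|tau| <= e * `|tau| by rewrite ler_wpM2r.
  have : - (e ^+ 2 * `|tau|) <= e ^+ 2 * tau by rewrite -mulrN ler_wpM2l// exprn_ge0// ltW.
  have : - (e * `|d|) <= e * d by rewrite -mulrN ler_wpM2l// ltW.
  by nra.
- have [e0 /andP[e00 e01] h] := key _ _ d0 K0; exists e0 => // e ep /[dup] /(h e ep) hK ee g.
  rewrite ler_norml => /andP[g1 _].
  have e1 : e < 1 by lra.
  have e2 : e ^+ 2 <= e by rewrite expr2; nra.
  suff : 0 < e * (d + e * tau - M * e ^+ 2) by move: g1; rewrite !exprS expr0; nra.
  rewrite mulr_gt0//.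
  have : M * e ^+ 2 <= M * e by rewrite ler_wpM2l.
  have : - (e * `|tau|) <= e * tau by rewrite -mulrN ler_wpM2l// ltW.
  by nra.
- have [e0 /andP[e00 e01] h] := key _ _ t0 K0; exists e0 => // e ep /[dup] /(h e ep) hK ee g.
  rewrite ler_norml => /andP[g1 _].
  suff : 0 < e ^+ 2 * (tau - M * e) by move: g1; rewrite !exprS expr0; nra.
  rewrite mulr_gt0 ?exprn_gt0//.
  by nra.
Unshelve. all: by end_near. Qed.

(* The value of the indicator function of the polygon near
   [y + sg * e *: (1, s i) + (0, tau * e ^+ 2)], for small [e > 0]. *)
Definition corner (R : realType) (s : nat -> R) (m i : nat) (sg tau : R) (y : plane R) : bool :=
  [forall j : 'I_m,
    lexpos (hgt (s j) y - hgt (s j) (chain s j)) (sg * (s i - s j)) tau &&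
    lexpos (hgt (s j) (chain s m - chain s j) - hgt (s j) y) (- (sg * (s i - s j))) (- tau)].

(** On a box of radius [e ^+ 3] every height is its second-order expansion up to an error of order
    [e ^+ 3], so the indicator is constant there. A whole box is required because the coverage is
    known only almost everywhere. *)
Lemma corner_near (R : realType) (s : nat -> R) (m i : nat) (sg tau : R) (y : plane R) :
  tau != 0 ->
  \forall e \near 0^'+, forall x,
    near_box (y + (sg * e, sg * e * s i + tau * e ^+ 2)) (e ^+ 3) x ->
    \1_(zonogon s m) x = (corner s m i sg tau y)%:R :> R.
Proof.
move=> t0.
have E (j : nat) (x : plane R) (e : R) : exists2 g,
    hgt (s j) x = hgt (s j) y + e * (sg * (s i - s j)) + e ^+ 2 * tau + g &
    near_box (y + (sg * e, sg * e * s i + tau * e ^+ 2)) (e ^+ 3) x ->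
    `|g| <= (1 + `|s j|) * e ^+ 3.
  exists (hgt (s j) (x - (y + (sg * e, sg * e * s i + tau * e ^+ 2)))).
    have w : hgt (s j) (sg * e, sg * e * s i + tau * e ^+ 2) =
        e * (sg * (s i - s j)) + e ^+ 2 * tau by rewrite /hgt /=; ring.
    by rewrite hgtD hgtN hgtD w; ring.
  move=> [h1 h2]; rewrite /hgt mulrDl mul1r.
  apply: le_trans (ler_normB _ _) _; apply: lerD; first exact: ltW.
  by rewrite normrM; apply: ler_wpM2l => //; exact: ltW.
have M0 (j : nat) : 0 <= 1 + `|s j| by rewrite addr_ge0.
have [/forallP c1|/forallPn[j]] := boolP (corner s m i sg tau y).
  have : \forall e \near 0^'+, forall j : 'I_m, forall g, `|g| <= (1 + `|s j|) * e ^+ 3 ->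
      0 < hgt (s j) y - hgt (s j) (chain s j) + e * (sg * (s i - s j)) + e ^+ 2 * tau + g /\
      0 < hgt (s j) (chain s m - chain s j) - hgt (s j) y
        + e * (- (sg * (s i - s j))) + e ^+ 2 * (- tau) + (- g).
    apply: filter_forall => j; have /andP[l1 l2] := c1 j.
    near=> e => g hg; split.
      by move: g hg; near: e; exact: lexpos_near.
    have {}hg : `|- g| <= (1 + `|s j|) * e ^+ 3 by rewrite normrN.
    by move: (- g) hg; near: e; exact: lexpos_near.
  apply: filterS => e h x hx; rewrite indicE mem_set// => j jm.
  have [g xE hg] := E j x e; have [/= h1 h2] := h (Ordinal jm) g (hg hx).
  by rewrite xE; apply/andP; split; lra.
rewrite negb_and => /orP[/(lexposN t0) l|/lexposN l].
  have := lexpos_near (M0 j) l; apply: filterS => e h x hx.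
  rewrite indicE memNset// => /(_ j (ltn_ord j))/andP[+ _]; apply/negP; rewrite -ltNge.
  have [g xE hg] := E j x e; have := h (- g); rewrite normrN => /(_ (hg hx)).
  by rewrite xE; lra.
have {}l : lexpos (- (hgt (s j) (chain s m - chain s j) - hgt (s j) y)) (sg * (s i - s j)) tau.
  by have := l; rewrite oppr_eq0 !opprK; apply.
have := lexpos_near (M0 j) l; apply: filterS => e h x hx.
rewrite indicE memNset// => /(_ j (ltn_ord j))/andP[_]; apply/negP; rewrite -ltNge.
have [g xE hg] := E j x e; have := h g (hg hx).
by rewrite xE; lra.
Unshelve. all: by end_near. Qed.

(** Here [h] and [h + d] are the values of an affine function at the ends of an edge. At a point
    before the far end, a small move forward makes the function positive. *)
Lemma lexpos_edge (R : realType) (h d tau r : R) :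
  0 <= h -> 0 <= h + d -> d != 0 -> 0 <= r -> r < 1 -> lexpos (h + r * d) d tau.
Proof.
move=> h0 h1 d0 r0 r1; rewrite /lexpos.
have [d_gt0|d_lt0|dE] := ltgtP 0 d; last by rewrite dE eqxx in d0.
  by rewrite /= andbT orbC eq_sym -le_eqVlt; nra.
by apply/orP; left; nra.
Qed.

Lemma lexpos_edgeN (R : realType) (h d tau r : R) :
  0 <= h -> 0 <= h + d -> d != 0 -> 0 < r -> r <= 1 -> lexpos (h + r * d) (- d) tau.
Proof.
move=> h0 h1 d0 r0 r1.
have -> : h + r * d = (h + d) + (1 - r) * (- d) by ring.
by apply: lexpos_edge; rewrite ?oppr_eq0//; lra.
Qed.

Lemma lexpos_tau (R : realType) (c d tau tau' : R) :
  (c != 0) || (d != 0) -> lexpos c d tau = lexpos c d tau'.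
Proof. by rewrite /lexpos => /orP[/negbTE->//|/negbTE->]; rewrite andFb. Qed.

Lemma slope_diff (R : realType) (s : nat -> R) (hs : {homo s : i j / (i < j)%N >-> i < j})
  (i j : nat) : i != j -> s i - s j != 0.
Proof.
rewrite subr_eq0 neq_ltn => /orP[] /hs h; by [rewrite lt_eqF|rewrite gt_eqF].
Qed.

Lemma strip_lt (R : realType) (s : nat -> R) (hs : {homo s : i j / (i < j)%N >-> i < j})
    (m i : nat) : (1 < m)%N -> (i < m)%N ->
  hgt (s i) (chain s i) < hgt (s i) (chain s m - chain s i).
Proof.
move=> m1 im; rewrite hgtD hgtN.
case: i im => [|i] im.
  rewrite hgt_chain0 subr0 -(hgt_chain0 s (s 0)); apply: hgt_chain_min_lt => //.
    by rewrite -lt0n ltnW.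
  by rewrite gtn_eqF.
have : hgt (s i.+1) (chain s i.+1) < 0 by rewrite -(hgt_chain0 s (s i.+1)) hgt_chain_lt.
by have := hgt_chain_min hs i.+1 m; lra.
Qed.

(** For the other strips the first-order term [sg * (s i - s j)] is nonzero and decides first; for
    strip [i] itself the zeroth-order terms decide. *)
Lemma corner_tau (R : realType) (s : nat -> R) (hs : {homo s : i j / (i < j)%N >-> i < j})
    (m i : nat) (sg tau tau' : R) (y : plane R) : sg != 0 ->
  hgt (s i) y != hgt (s i) (chain s i) ->
  hgt (s i) y != hgt (s i) (chain s m - chain s i) ->
  corner s m i sg tau y = corner s m i sg tau' y.
Proof.
move=> sg0 ylo yhi; apply: eq_forallb => j.
have [->|ji] := eqVneq (val j) i.
  by congr (_ && _); apply: lexpos_tau; rewrite subr_eq0 ?ylo// eq_sym yhi.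
have d0 : sg * (s i - s j) != 0 by rewrite mulf_neq0// slope_diff// eq_sym.
by congr (_ && _); apply: lexpos_tau; rewrite ?oppr_eq0 d0 orbT.
Qed.

Lemma corner_sym (R : realType) (s : nat -> R) (m i : nat) (sg tau : R) (y : plane R) :
  corner s m i sg tau (chain s m - y) = corner s m i (- sg) (- tau) y.
Proof.
apply: eq_forallb => j; rewrite !hgtD !hgtN andbC mulNr !opprK.
by congr (_ && _); congr lexpos; ring.
Qed.

Lemma lower_edge (R : realType) (s : nat -> R) (i : nat) (y : plane R) (a : R) :
  hgt (s i) y = hgt (s i) (chain s i) ->
  hgt a y = hgt a (chain s i) + (y.1 - i%:R) * (s i - a).
Proof.
rewrite /hgt /= => E.
have -> : (y.2 : R) = s i * y.1 + (\sum_(i0 < i) s i0 - s i * i%:R) by rewrite -E; ring.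
by ring.
Qed.

Lemma corner_lower_neg (R : realType) (s : nat -> R) (m i : nat) (sg : R) (y : plane R) :
  (i < m)%N -> hgt (s i) y = hgt (s i) (chain s i) -> corner s m i sg (-1) y = false.
Proof.
move=> im E; apply/negbTE/forallPn; exists (Ordinal im) => /=.
by rewrite E !subrr mulr0 /lexpos ltxx eqxx/= ltr0N1.
Qed.

(** With [r] the parameter along the edge, [lo] and [hi] are the slacks in strip [j] at its left
    end. The two neighbouring edges force the bounds on [r]; conversely [lexpos_edge] and
    [lexpos_edgeN] handle all other strips. *)
Lemma corner_lower (R : realType) (s : nat -> R) (hs : {homo s : i j / (i < j)%N >-> i < j})
    (m i : nat) (y : plane R) : (1 < m)%N -> (i < m)%N ->
  hgt (s i) y = hgt (s i) (chain s i) ->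
  corner s m i 1 1 y = (0 <= y.1 - i%:R < 1) /\
  corner s m i (-1) 1 y = (0 < y.1 - i%:R <= 1).
Proof.
move=> m1 im E; set r : R := y.1 - i%:R.
pose lo (j : nat) := hgt (s j) (chain s i) - hgt (s j) (chain s j).
pose hi (j : nat) := hgt (s j) (chain s m - chain s j) - hgt (s j) (chain s i).
have yl j : hgt (s j) y - hgt (s j) (chain s j) = lo j + r * (s i - s j).
  by rewrite (lower_edge _ E) /lo /r; ring.
have yh j : hgt (s j) (chain s m - chain s j) - hgt (s j) y = hi j + r * (- (s i - s j)).
  by rewrite (lower_edge _ E) /hi /r; ring.
have lo0 j : (j < m)%N -> 0 <= lo j.
  by move=> jm; rewrite subr_ge0; have /andP[] := zonogon_chain hs (ltnW im) jm.
have hi0 j : (j < m)%N -> 0 <= hi j.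
  by move=> jm; rewrite subr_ge0; have /andP[] := zonogon_chain hs (ltnW im) jm.
have lo1 j : (j < m)%N -> 0 <= lo j + (s i - s j).
  move=> jm; have /andP[+ _] := zonogon_chain hs im jm.
  by rewrite hgt_chainS /lo; lra.
have hi1 j : (j < m)%N -> 0 <= hi j + - (s i - s j).
  move=> jm; have /andP[_] := zonogon_chain hs im jm.
  by rewrite hgt_chainS /hi; lra.
have strip : 0 < hgt (s i) (chain s m - chain s i) - hgt (s i) (chain s i).
  by rewrite subr_gt0 strip_lt.
(* The bound at the left end comes from the preceding edge: lower edge [i.-1], or, when [i = 0], the
   last upper edge, which meets the chain at the origin. *)
have onA sg : corner s m i sg 1 y -> (0 <= r) /\ (sg = -1 -> r != 0).
  case: (posnP i) => [i0|i0] /forallP c.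
    have mm : (m.-1 < m)%N by rewrite prednK// ltnW.
    have hE : hi m.-1 = 0.
      by rewrite /hi i0 hgt_chain0 hgtD hgtN -hgt_chain_flat prednK ?(ltnW m1)// subrr subr0.
    have d : 0 < - (s i - s m.-1) by rewrite opprB subr_gt0 hs// i0; lia.
    have := c (Ordinal mm); rewrite /= yh hE add0r => /andP[_].
    rewrite /lexpos pmulr_lgt0// mulf_eq0 (gt_eqF d) orbF.
    move=> /orP[r0|/andP[/eqP-> h]]; first by split=> [|_]; rewrite ?ltW// gt_eqF.
    by split=> // sgE; move: h; rewrite sgE mulN1r opprK => /orP[|/andP[/eqP]]; lra.
  have im' : (i.-1 < m)%N by lia.
  have d : 0 < s i - s i.-1 by rewrite subr_gt0 hs//; lia.
  have lE : lo i.-1 = 0.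
    by have := hgt_chain_flat s i.-1; rewrite prednK// /lo => ->; rewrite subrr.
  have := c (Ordinal im'); rewrite /= yl lE add0r => /andP[+ _].
  rewrite /lexpos pmulr_lgt0// mulf_eq0 (gt_eqF d) orbF.
  move=> /orP[r0|/andP[/eqP-> h]]; first by split=> [|_]; rewrite ?ltW// gt_eqF.
  by split=> // sgE; move: h; rewrite sgE mulN1r => /orP[|/andP[/eqP]]; lra.
(* The bound at the right end comes from lower edge [i.+1], or from upper edge 0 when edge [i] is
   the last one. *)
have onB sg : corner s m i sg 1 y -> (r <= 1) /\ (sg = 1 -> r != 1).
  have fin (d h tau : R) : 0 < d -> lexpos (h + (- d) + (r - 1) * (- d)) (sg * (- d)) tau ->
      h = d ->
      (r <= 1) /\ (sg = 1 -> r != 1).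
    move=> d0 + hE; rewrite hE subrr add0r /lexpos mulrN -mulNr opprB.
    rewrite pmulr_lgt0// subr_gt0 mulf_eq0 (gt_eqF d0) orbF.
    move=> /orP[r1|/andP[/eqP r1 h1]]; first by split=> [|_]; rewrite ?ltW// lt_eqF.
    split; first by lra.
    by move=> sgE; move: h1; rewrite sgE mul1r => /orP[|/andP[/eqP]]; lra.
  move=> /forallP c; have [iE|im1] := eqVneq i.+1 m.
    have m0 : (0 < m)%N by exact: ltnW.
    have d : 0 < s i - s 0 by rewrite subr_gt0 hs//; lia.
    have := c (Ordinal m0); rewrite /= yh => /andP[_ l].
    apply: (fin _ (hi 0) (-1) d).
      by move: l; rewrite -mulrN; congr (is_true (lexpos _ _ _)); ring.
    by rewrite /hi -iE hgtD hgtN hgt_chain0 hgt_chainS; ring.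
  have im2 : (i.+1 < m)%N by lia.
  have d : 0 < s i.+1 - s i by rewrite subr_gt0 hs.
  have := c (Ordinal im2); rewrite /= yl => /andP[l _].
  apply: (fin _ (lo i.+1) 1 d).
    by move: l; congr (is_true (lexpos _ _ _)); ring.
  by rewrite /lo hgt_chainS; ring.
have mk (sg : R) : (sg = 1 /\ 0 <= r < 1) \/ (sg = -1 /\ 0 < r <= 1) -> corner s m i sg 1 y.
  move=> sgr; apply/forallP => j; have jm := ltn_ord j.
  have [jE|ji] := eqVneq (val j) i.
    rewrite jE E !subrr mulr0 oppr0 /lexpos ltxx eqxx/= ltr01/=.
    by rewrite strip.
  have d : s i - s j != 0 by apply: slope_diff => //; rewrite eq_sym.
  rewrite yl yh; case: sgr => -[-> /andP[r0 r1]].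
    rewrite !mul1r; apply/andP; split; apply: lexpos_edge; rewrite ?oppr_eq0 ?lo0 ?lo1 ?hi0 ?hi1//.
  rewrite !mulN1r; apply/andP; split; apply: lexpos_edgeN; rewrite ?oppr_eq0 ?lo0 ?lo1 ?hi0 ?hi1//.
split; apply/idP/idP => h.
- have [a _] := onA _ h; have [b b'] := onB _ h.
  by rewrite a lt_neqAle b b'.
- by apply: mk; left.
- have [a a'] := onA _ h; have [b _] := onB _ h.
  by rewrite b lt0r a a'.
- by apply: mk; right.
Qed.

(** The mixed second difference of the local indicator, with sign [sg * tau]; it cancels constants
    and whatever depends on one displacement only. *)
Definition corner_diff (R : realType) (s : nat -> R) (m i : nat) (y : plane R) : R :=
  (corner s m i 1 1 y)%:R - (corner s m i 1 (-1) y)%:R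
  - (corner s m i (-1) 1 y)%:R + (corner s m i (-1) (-1) y)%:R.

Lemma corner_diff_sym (R : realType) (s : nat -> R) (m i : nat) (y : plane R) :
  corner_diff s m i (chain s m - y) = corner_diff s m i y.
Proof. by rewrite /corner_diff !corner_sym !opprK; ring. Qed.

Lemma corner_diff_lower (R : realType) (s : nat -> R) (hs : {homo s : i j / (i < j)%N >-> i < j})
    (m i : nat) (y : plane R) : (1 < m)%N -> (i < m)%N ->
  hgt (s i) y = hgt (s i) (chain s i) ->
  corner_diff s m i y = (y == chain s i)%:R - (y == chain s i.+1)%:R.
Proof.
move=> m1 im E; rewrite /corner_diff !corner_lower_neg//.
have [-> ->] := corner_lower hs m1 im E.
set r : R := y.1 - i%:R.
have -> : (y == chain s i) = (r == 0).
  apply/eqP/eqP => [yE|]; first by rewrite /r yE subrr.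
  move=> /eqP; rewrite subr_eq0 => /eqP y1; apply: plane_eq => //.
  by move: E; rewrite /hgt y1 /=; lra.
have -> : (y == chain s i.+1) = (r == 1).
  apply/eqP/eqP => [yE|r1]; first by rewrite /r yE chainS /= addrC addKr.
  have y1 : y.1 = i.+1%:R :> R by rewrite -[LHS](subrK (i%:R : R)) -/r r1 addrC natr1.
  apply: plane_eq => //.
  by move: E; rewrite /hgt y1 /= big_ord_recr /= -natr1; lra.
case: (ltgtP r 0) => [r0|r0|->] /=.
- have -> : (r == 1) = false by apply/negbTE/eqP; lra.
  by rewrite /=; ring.
- by case: (ltgtP r 1) => [r1|r1|r1] /=; ring.
- by rewrite ltr01 eq_sym oner_eq0 /=; ring.
Qed.

(** On the lower line the difference of the indicators of [0 <= r < 1] and [0 < r <= 1] leaves only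
    the two ends. The upper line follows by symmetry, and off both lines [tau] has no effect. *)
Lemma corner_diffE (R : realType) (s : nat -> R) (hs : {homo s : i j / (i < j)%N >-> i < j})
    (m i : nat) (y : plane R) : (1 < m)%N -> (i < m)%N ->
  corner_diff s m i y = (y == chain s i)%:R - (y == chain s i.+1)%:R
    - (y == chain s m - chain s i.+1)%:R + (y == chain s m - chain s i)%:R.
Proof.
move=> m1 im; have lt := strip_lt hs m1 im.
have flat := hgt_chain_flat s i.
have flat' : hgt (s i) (chain s m - chain s i.+1) = hgt (s i) (chain s m - chain s i).
  by rewrite !hgtD !hgtN flat.
have ne (x : plane R) : hgt (s i) y != hgt (s i) x -> (y == x) = false.
  by move=> h; apply/negbTE; apply: contra h => /eqP ->.
have [E|lo] := eqVneq (hgt (s i) y) (hgt (s i) (chain s i)).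
  rewrite (corner_diff_lower hs m1 im E) (ne (_ - chain s i)) ?E ?lt_eqF//.
  by rewrite (ne (_ - chain s i.+1)) ?E ?flat' ?lt_eqF//; ring.
rewrite (ne (chain s i))// (ne (chain s i.+1)) ?flat//.
have [E|hi] := eqVneq (hgt (s i) y) (hgt (s i) (chain s m - chain s i)).
  rewrite -corner_diff_sym (corner_diff_lower hs m1 im).
    have sw (x : plane R) : (chain s m - y == x) = (y == chain s m - x).
      by apply/eqP/eqP => [<-|->]; rewrite subKr.
    by rewrite !sw; ring.
  by rewrite hgtD hgtN E hgtD hgtN; ring.
rewrite (ne (_ - chain s i))// (ne (_ - chain s i.+1)) ?flat'//.
have N0 : -1 != 0 :> R by rewrite oppr_eq0 oner_eq0.
rewrite /corner_diff (corner_tau hs 1 (-1) (oner_neq0 R) lo hi).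
by rewrite (corner_tau hs 1 (-1) N0 lo hi) /=; ring.
Qed.

(** * From the tiling condition to an identity for the multiplicities *)

Lemma near_forall_seq (R : realType) (T : eqType) (X : seq T) (Q : T -> R -> Prop) :
  (forall l, \forall e \near 0^'+, Q l e) -> \forall e \near 0^'+, forall l, l \in X -> Q l e.
Proof.
move=> h; elim: X => [|a X IH]; first by near=> e.
have := h a; apply: filterS2 IH => e IH Qa l.
by rewrite inE => /predU1P[->|/IH].
Unshelve. all: by end_near. Qed.

Lemma zonogon_bounded (R : realType) (s : nat -> R) (hs : {homo s : i j / (i < j)%N >-> i < j})
    (m : nat) : (1 < m)%N -> exists2 K : R, 0 <= K & forall z, zonogon s m z -> near_box 0 K z.
Proof.
move=> m1; pose H := hgt (s 0) (chain s m).
exists (`|H| + (1 + `|s 0|) * m%:R + 1); first by rewrite !addr_ge0 ?mulr_ge0 ?addr_ge0.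
move=> z Pz; have /andP[x0 xm] := zonogon_fst hs m1 Pz.
have /andP[] := Pz 0%N (ltnW m1).
rewrite hgtD hgtN hgt_chain0 subr0 -/H /hgt => y0 yH.
have sx : `|s 0 * z.1| <= `|s 0| * m%:R by rewrite normrM ler_wpM2l// ger0_norm.
have H0 := ler_norm H; have s0 := normr_ge0 (s 0).
have sm : 0 <= `|s 0| * m%:R by rewrite mulr_ge0.
rewrite mulrDl mul1r.
move: sx; rewrite /near_box /= !subr0 ler_norml => /andP[sx1 sx2].
have Hn := normr_ge0 H.
set y : R := z.2 in y0 yH *; set x : R := z.1 in x0 xm y0 yH sx1 sx2 *.
by split; rewrite ltr_norml; apply/andP; split; lra.
Qed.

Lemma sum_delta (R : realType) (T : eqType) (X : seq T) (f : T -> R) (a : T) : uniq X ->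
  (a \notin X -> f a = 0) -> \sum_(l <- X) f l * (l == a)%:R = f a.
Proof.
move=> uX fa; have [aX|aX] := boolP (a \in X).
  rewrite (bigD1_seq a)//= eqxx mulr1 big1 ?addr0// => l /negbTE->.
  by rewrite mulr0.
rewrite fa// big_seq big1// => l lX.
have [la|] := eqVneq l a; last by rewrite mulr0.
by rewrite -la lX in aX.
Qed.

(** The coverage equals [k] near each of the four displacements of [p], so its mixed second
    difference vanishes; by [corner_diffE] only the translates having [p] at an end of edge [i] or
    of the opposite edge remain. *)
Lemma vertex_identity (R : realType) (s : nat -> R) (hs : {homo s : i j / (i < j)%N >-> i < j})
    (m i k : nat) (L : plane R -> nat) (r : R) (p : plane R) : (1 < m)%N -> (i < m)%N ->
  0 < r -> locally_at_most (msupport L) r k ->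
  {ae (@lebesgue_measure R \x @lebesgue_measure R)%E,
     forall x : plane R, coverage (zonogon s m) L x = (k%:R)%:E} ->
  (L (p - chain s i))%:R - (L (p - chain s i.+1))%:R
  - (L (p - (chain s m - chain s i.+1)))%:R + (L (p - (chain s m - chain s i)))%:R = 0 :> R.
Proof.
move=> m1 im r0 Lloc tile.
have [K K0 PK] := zonogon_bounded hs m1.
(* Large enough that every translate meeting a displaced point, for [e < 1], has its index in the
   box of radius [D] about [p]. *)
pose D := K + 3 + `|s i|.
have /finite_seqP[X0 X0E] := locally_finite p D r0 Lloc.
pose X := undup X0.
have uX : uniq X by exact: undup_uniq.
have inX l : msupport L l -> near_box p D l -> l \in X.
  move=> Ll lp; rewrite mem_undup.
  have : [set` X0] l by rewrite -X0E.
  by [].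
have vX v : zonogon s m v -> \sum_(l <- X) (L l)%:R * (p - l == v)%:R = (L (p - v))%:R :> R.
  move=> Pv; rewrite -[RHS](@sum_delta R _ X (fun l => (L l)%:R)) //.
    apply: eq_bigr => l _; congr (_ * (nat_of_bool _)%:R).
    by apply/eqP/eqP => [<-|->]; rewrite subKr.
  move=> nX; apply/eqP; rewrite pnatr_eq0 -leqn0 leqNgt; apply: contra nX => Lv.
  apply: inX => //; have [v1 v2] := PK v Pv.
  have si := normr_ge0 (s i).
  move: v1 v2; rewrite /near_box /= !subr0 => v1 v2.
  by split; rewrite /= [X in X - _]addrC addrK normrN;
    apply: (lt_le_trans v1) || apply: (lt_le_trans v2); rewrite /D; lra.
have Q (sg tau : R) : tau != 0 -> \forall e \near 0^'+, forall l, l \in X -> forall x,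
    near_box (p - l + (sg * e, sg * e * s i + tau * e ^+ 2)) (e ^+ 3) x ->
    \1_(zonogon s m) x = (corner s m i sg tau (p - l))%:R :> R.
  by move=> t0; apply: near_forall_seq => l; exact: corner_near.
(* For one small [e] valid for all of [X], a point of coverage [k] is picked in the box of radius
   [e ^+ 3]. *)
have T (sg tau : R) : `|sg| = 1 -> `|tau| = 1 ->
    \sum_(l <- X) (L l)%:R * (corner s m i sg tau (p - l))%:R = k%:R :> R.
  move=> sg1 tau1; have t0 : tau != 0 by rewrite -normr_gt0 tau1.
  near (0 : R)^'+ => e.
  have e0 : 0 < e by near: e; exact: nbhs_right_gt.
  have e1 : e < 1 by near: e; exact: nbhs_right_lt.
  have hQ : forall l, l \in X -> forall x,
    near_box (p - l + (sg * e, sg * e * s i + tau * e ^+ 2)) (e ^+ 3) x ->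
    \1_(zonogon s m) x = (corner s m i sg tau (p - l))%:R :> R by near: e; exact: Q.
  have e3 : 0 < e ^+ 3 by rewrite exprn_gt0.
  have [x [x1 x2] cx] := ae_near_box (p + (sg * e, sg * e * s i + tau * e ^+ 2)) e3 tile.
  rewrite -(coverage_sum cx uX).
    rewrite big_seq [RHS]big_seq; apply: eq_bigr => l lX; rewrite (hQ l lX (x - l))//.
    have sh (a b c d : R) : a - d - (b - d + c) = a - (b + c) by ring.
    by split; rewrite /= sh.
  move=> l Ll /PK[/=]; rewrite !subr0 => l1 l2; apply: inX => //.
  move: x1 x2 l1 l2 => /=.
  have e2' : e ^+ 2 <= 1 by rewrite expr_le1// ltW.
  have e3' : e ^+ 3 <= 1 by rewrite expr_le1// ltW.
  have sge : `|sg * e| <= 1 by rewrite normrM sg1 mul1r gtr0_norm// ltW.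
  have si : `|sg * e * s i| <= `|s i| by rewrite normrM ler_piMl.
  have te : `|tau * e ^+ 2| <= 1 by rewrite normrM tau1 mul1r gtr0_norm// exprn_gt0.
  have nsi := normr_ge0 (s i).
  set a : R := sg * e in sge si *; set b := a * s i in si *; set c := tau * e ^+ 2 in te *.
  have fin (u v w q : R) : `|q| <= 1 + `|s i| -> `|u - (v + q)| < e ^+ 3 ->
      `|u - w| < K -> `|w - v| < D.
    rewrite /D ler_norml !ltr_norml => /andP[? ?] /andP[? ?] /andP[? ?]; apply/andP; split; lra.
  move=> x1 x2 l1 l2; split; [apply: fin x1 l1|apply: fin x2 l2]; first by lra.
  by apply: le_trans (ler_normD _ _) _; lra.
have := T 1 1; have := T 1 (-1); have := T (-1) 1; have := T (-1) (-1).
rewrite normrN1 normr1 => /(_ erefl erefl) Tmm /(_ erefl erefl) Tmp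
  /(_ erefl erefl) Tpm /(_ erefl erefl) Tpp.
have : \sum_(l <- X) (L l)%:R * corner_diff s m i (p - l) = 0 :> R.
  under eq_bigr do rewrite /corner_diff mulrDr !mulrBr.
  by rewrite !big_split/= !sumrN Tpp Tpm Tmp Tmm; ring.
under eq_bigr do rewrite (corner_diffE hs _ m1 im) mulrDr !mulrBr.
rewrite !big_split/= !sumrN !vX//.
all: try apply: zonogon_sym; apply: zonogon_chain => //; exact: ltnW.
Unshelve. all: by end_near. Qed.

(** * Rationally independent directions *)

(** The translation carrying lower edge [i] onto the opposite upper edge. *)
Definition cross (R : realType) (s : nat -> R) (m i : nat) : plane R :=
  chain s m - chain s i - chain s i.+1.

Lemma rectangle_identity (R : realType) (s : nat -> R) (hs : {homo s : i j / (i < j)%N >-> i < j})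
    (m i k : nat) (L : plane R -> nat) (r : R) (x : plane R) : (1 < m)%N -> (i < m)%N ->
  0 < r -> locally_at_most (msupport L) r k ->
  {ae (@lebesgue_measure R \x @lebesgue_measure R)%E,
     forall x : plane R, coverage (zonogon s m) L x = (k%:R)%:E} ->
  (L x + L (x + (1, s i) + cross s m i)%R = L (x + (1, s i))%R + L (x + cross s m i)%R)%N.
Proof.
move=> m1 im r0 Lloc tile; set e : plane R := (1, s i).
have eE : chain s i.+1 = chain s i + e by rewrite chainS.
(* This base point turns the four arguments into the corners of the parallelogram spanned at [x] by
   [e] and [cross s m i]. *)
have := vertex_identity hs (x + (chain s m - chain s i)) m1 im r0 Lloc tile.
have -> : x + (chain s m - chain s i) - chain s i = x + e + cross s m i.
  by rewrite /cross eE; apply: plane_eq => /=; ring.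
have -> : x + (chain s m - chain s i) - chain s i.+1 = x + cross s m i.
  by rewrite /cross addrA !addrA.
have -> : x + (chain s m - chain s i) - (chain s m - chain s i.+1) = x + e.
  by rewrite eE; apply: plane_eq => /=; ring.
rewrite addrK => h; apply/eqP; rewrite -(eqr_nat R) !natrD; apply/eqP.
by lra.
Qed.

(** The relation propagates to all multiples [n] of [e] and [l] of [t]. If [L] vanished at some
    [a + e *+ n] and some [a + t *+ l], the sum of [L a] and a natural number would be 0. *)
Lemma ray_dichotomy (V : nmodType) (L : V -> nat) (e t : V) :
  (forall x, L x + L (x + e + t)%R = L (x + e)%R + L (x + t)%R)%N ->
  forall a, (0 < L a)%N -> exists b : bool, forall n, (0 < L (a + (if b then e else t) *+ n)%R)%N.
Proof.
move=> h a La.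
have h1 x n : (L x + L (x + e *+ n + t)%R = L (x + e *+ n)%R + L (x + t)%R)%N.
  elim: n => [|n IH]; first by rewrite mulr0n addr0 addnC.
  by have := h (x + e *+ n); rewrite mulrSr addrA; lia.
have h2 x n l : (L x + L (x + e *+ n + t *+ l)%R = L (x + e *+ n)%R + L (x + t *+ l)%R)%N.
  elim: l => [|l IH]; first by rewrite mulr0n !addr0 addnC.
  have := h1 (x + t *+ l) n; rewrite mulrSr !addrA.
  by rewrite (addrAC x (t *+ l)); lia.
have [he|/existsNP[n /negP]] := pselect (forall n, (0 < L (a + e *+ n)%R)%N).
  by exists true.
rewrite -eqn0Ngt => /eqP Ln; exists false => l; rewrite lt0n; apply/eqP => Ll.
by have := h2 a n l; lia.
Qed.

(** * Integer coordinates and the choice of slopes *)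

(** An injective additive map from integer triples to the plane; it turns independence of three
    directions into a 3 by 3 determinant condition. *)
Definition vec (R : realType) (x y z : int) : plane R :=
  (x%:~R, y%:~R + z%:~R * Num.sqrt 2).

(** For nonzero [c] the 2-adic valuation of the left side is even and that of the right side odd. *)
Lemma sqr_double_eq0 (b c : nat) : (b ^ 2 = 2 * c ^ 2)%N -> c = 0%N.
Proof.
move=> h; apply/eqP; rewrite -leqn0 leqNgt; apply/negP => c0.
have b0 : (0 < b)%N by rewrite lt0n; apply/eqP => b0; move: h; rewrite b0; nia.
have := congr1 (logn 2) h; rewrite lognM ?expn_gt0 ?c0// !lognX (@logn_prime 2 2 isT) eqxx.
by lia.
Qed.

Lemma sqrt2_free (R : realType) (y z : int) :
  y%:~R + z%:~R * Num.sqrt 2 = 0 :> R -> y = 0 /\ z = 0.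
Proof.
move=> h; have zE : z = 0.
  have : (y ^+ 2)%:~R = (2 * z ^+ 2)%:~R :> R.
    rewrite intrM !rmorphXn /=.
    have -> : y%:~R = - (z%:~R * Num.sqrt 2) :> R by lra.
    by rewrite sqrrN exprMn sqr_sqrtr// mulrC.
  move=> /intr_inj e; apply/eqP; rewrite -absz_eq0; apply/eqP.
  apply: (@sqr_double_eq0 `|y|).
  by have := congr1 absz e; rewrite abszM !abszX.
by move: h; rewrite zE mul0r addr0 => /eqP; rewrite intr_eq0 => /eqP.
Qed.

Lemma vec_inj (R : realType) (x y z x' y' z' : int) :
  vec R x y z = vec R x' y' z' -> [/\ x = x', y = y' & z = z'].
Proof.
move=> [/intr_inj -> h].
have /sqrt2_free[] : (y - y')%:~R + (z - z')%:~R * Num.sqrt 2 = 0 :> R.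
  by rewrite !intrB; lra.
by move=> /eqP; rewrite subr_eq0 => /eqP -> /eqP; rewrite subr_eq0 => /eqP ->.
Qed.

Lemma vec_comb (R : realType) (x y z x' y' z' x'' y'' z'' : int) (n n' n'' : nat) :
  vec R x y z *+ n + vec R x' y' z' *+ n' + vec R x'' y'' z'' *+ n'' =
  vec R (x * n + x' * n' + x'' * n'') (y * n + y' * n' + y'' * n'') (z * n + z' * n' + z'' * n'').
Proof.
have vD a b c a' b' c' : vec R a b c + vec R a' b' c' = vec R (a + a') (b + b') (c + c').
  by rewrite /vec !intrD; apply: plane_eq => //=; ring.
have vM a b c j : vec R a b c *+ j = vec R (a * j) (b * j) (c * j).
  elim: j => [|j IH]; first by rewrite mulr0n !mulr0 /vec mul0r addr0.
  by rewrite mulrSr IH vD; congr vec; lia.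
by rewrite !vM !vD.
Qed.

(** The first three edges have coordinates (1,0,0), (1,1,0), (1,0,1). The later slopes keep the
    sequence increasing and give [chain] equal second and third coordinates. *)
Definition slope (R : realType) (j : nat) : R :=
  match j with
  | 0 => 0
  | 1 => 1
  | 2 => Num.sqrt 2
  | _ => j%:R * (1 + Num.sqrt 2)
  end.

Lemma slope_homo (R : realType) : {homo slope R : i j / (i < j)%N >-> i < j}.
Proof.
apply: homo_ltn; first exact: lt_trans.
have s1 : 1 < Num.sqrt 2 :> R by rewrite -[ltLHS]sqrtr1 ltr_sqrt ?ltr1n.
move=> [|[|[|i]]] /=; rewrite ?ltr01//; first by lra.
by rewrite ltr_pM2r ?ltr_nat//; lra.
Qed.

(** [T] is the sum of the indices from 3 to [m - 1], each at least 3; the lower bound later keeps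
    determinants away from zero. *)
Lemma chain_slope (R : realType) (m : nat) : (2 < m)%N -> exists2 T : nat, (3 * (m - 3) <= T)%N &
  chain (slope R) m = vec R m T.+1 T.+1.
Proof.
elim: m => // m IH; rewrite ltnS leq_eqVlt => /predU1P[<-|m2].
  exists 0%N => //; rewrite /chain /vec !big_ord_recr big_ord0/=.
  by congr pair; ring.
have [T Tm E] := IH m2; exists (T + m)%N; first by lia.
have sm : slope R m = m%:R * (1 + Num.sqrt 2) by case: m m2 {IH Tm E} => [|[|[|]]].
rewrite chainS E sm /vec; apply: plane_eq; first by rewrite /= -[in RHS]addn1 PoszD intrD.
by rewrite /= -!addSn !PoszD !intrD; ring.
Qed.

(** The differences solve a homogeneous system; combining its equations with cofactors as
    coefficients gives [D] times each difference. *)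
Lemma cramer3 (x0 x1 x2 y0 y1 y2 z0 z1 z2 : int) (n0 n1 n2 m0 m1 m2 : nat) :
  x0 * (y1 * z2 - y2 * z1) - x1 * (y0 * z2 - y2 * z0) + x2 * (y0 * z1 - y1 * z0) != 0 ->
  x0 * n0 + x1 * n1 + x2 * n2 = x0 * m0 + x1 * m1 + x2 * m2 ->
  y0 * n0 + y1 * n1 + y2 * n2 = y0 * m0 + y1 * m1 + y2 * m2 ->
  z0 * n0 + z1 * n1 + z2 * n2 = z0 * m0 + z1 * m1 + z2 * m2 ->
  [/\ n0 = m0, n1 = m1 & n2 = m2].
Proof.
set D := (X in X != 0) => D0.
pose a := n0%:Z - m0%:Z; pose b := n1%:Z - m1%:Z; pose c := n2%:Z - m2%:Z.
move=> E1 E2 E3.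
have {}E1 : x0 * a + x1 * b + x2 * c = 0 by rewrite /a /b /c; lia.
have {}E2 : y0 * a + y1 * b + y2 * c = 0 by rewrite /a /b /c; lia.
have {}E3 : z0 * a + z1 * b + z2 * c = 0 by rewrite /a /b /c; lia.
have zero t (p q r : int) : D * t = p * (x0 * a + x1 * b + x2 * c) +
    q * (y0 * a + y1 * b + y2 * c) + r * (z0 * a + z1 * b + z2 * c) -> t = 0.
  rewrite E1 E2 E3 !mulr0 !addr0 => /eqP.
  by rewrite mulf_eq0 (negbTE D0) => /eqP.
have a0 : a = 0.
  by apply: (zero _ (y1 * z2 - y2 * z1) (x2 * z1 - x1 * z2) (x1 * y2 - x2 * y1)); rewrite /D; ring.
have b0 : b = 0.
  by apply: (zero _ (y2 * z0 - y0 * z2) (x0 * z2 - x2 * z0) (x2 * y0 - x0 * y2)); rewrite /D; ring.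
have c0 : c = 0.
  by apply: (zero _ (y0 * z1 - y1 * z0) (x1 * z0 - x0 * z1) (x0 * y1 - x1 * y0)); rewrite /D; ring.
by move: a0 b0 c0; rewrite /a /b /c; split; lia.
Qed.

Lemma slope_free (R : realType) (m : nat) (u := fun i (b : bool) =>
    if b then ((1, slope R i) : plane R) else cross (slope R) m i) : (3 < m)%N ->
  forall (b0 b1 b2 : bool) (n0 n1 n2 m0 m1 m2 : nat),
    u 0%N b0 *+ n0 + u 1%N b1 *+ n1 + u 2 b2 *+ n2 =
    u 0%N b0 *+ m0 + u 1%N b1 *+ m1 + u 2 b2 *+ m2 ->
  [/\ n0 = m0, n1 = m1 & n2 = m2].
Proof.
move=> m3; have [T Tm cE] := chain_slope R (ltnW m3).
have c1 : chain (slope R) 1 = vec R 1 0 0.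
  by rewrite /chain /vec big_ord_recr big_ord0/=; congr pair; ring.
have c2 : chain (slope R) 2 = vec R 2 1 0.
  by rewrite /chain /vec !big_ord_recr big_ord0/=; congr pair; ring.
have c3 : chain (slope R) 3 = vec R 3 1 1.
  by rewrite /chain /vec !big_ord_recr big_ord0/=; congr pair; ring.
have vB a b c a' b' c' : vec R a b c - vec R a' b' c' = vec R (a - a') (b - b') (c - c').
  by rewrite /vec !intrB; apply: plane_eq => //=; ring.
have u0 b : u 0%N b = if b then vec R 1 0 0 else vec R (m%:Z - 1) T.+1 T.+1.
  case: b; rewrite /u /=; first by rewrite /vec mul0r addr0.
  by rewrite /cross chain0 cE c1 subr0 vB; congr vec; lia.
have u1 b : u 1%N b = if b then vec R 1 1 0 else vec R (m%:Z - 3) T T.+1.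
  case: b; rewrite /u /=; first by rewrite /vec mul0r addr0.
  by rewrite /cross cE c1 c2 !vB; congr vec; lia.
have u2 b : u 2 b = if b then vec R 1 0 1 else vec R (m%:Z - 5) (T%:Z - 1) T.
  case: b; rewrite /u /=; first by rewrite /vec mul1r add0r.
  by rewrite /cross cE c2 c3 !vB; congr vec; lia.
move=> b0 b1 b2 n0 n1 n2 m0 m1 m2; rewrite u0 u1 u2.
set M : int := m%:Z; have M4 : 4 <= M by lia.
have TM : 3 * (M - 3) <= T%:Z by lia.
(* The eight determinants take the values 1, [T], [M - 2T - 3] and [3T - M + 4], all nonzero as
   [M >= 4] and [T >= 3(M - 3)]. For [M = 3] and [T = 0] some would vanish. *)
by case: b0; case: b1; case: b2; rewrite !vec_comb => /vec_inj[E1 E2 E3];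
  apply: cramer3 E1 E2 E3; rewrite -/M; lia.
Qed.

(** * A box inside the polygon and the contradiction *)

Lemma zonogon_box (R : realType) (s : nat -> R) (hs : {homo s : i j / (i < j)%N >-> i < j})
    (m : nat) : (1 < m)%N ->
  exists c, exists2 r, 0 < r & near_box c (r + r) `<=` zonogon s m.
Proof.
move=> m1; exists (2^-1 *: chain s m).
have cE a : hgt a (2^-1 *: chain s m) = 2^-1 * hgt a (chain s m).
  by rewrite /hgt /= /GRing.scale/=; ring.
pose w (j : nat) := hgt (s j) (chain s m - chain s j) - hgt (s j) (chain s j).
near (0 : R)^'+ => r.
have r0 : 0 < r by near: r; exact: nbhs_right_gt.
exists r => //.
(* The centre is in the middle of each strip, of vertical width [w j]. Within a box of radius [2r]
   the height varies by at most [2r(1 + |s j|)], which is then below [w j / 2]. *)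
have rw : forall j : 'I_m, r < w j / (4 * (1 + `|s j|)).
  near: r; apply: filter_forall => j; apply: nbhs_right_lt.
  by rewrite divr_gt0 ?subr_gt0 ?strip_lt// mulr_gt0// ltr_wpDr.
move=> z [z1 z2] j jm.
have := rw (Ordinal jm); rewrite ltr_pdivlMr/=; last by rewrite mulr_gt0// ltr_wpDr.
move=> rj.
have : `|hgt (s j) (z - 2^-1 *: chain s m)| <= (1 + `|s j|) * (r + r).
  rewrite /hgt mulrDl mul1r; apply: le_trans (ler_normB _ _) _; apply: lerD; first exact: ltW.
  by rewrite normrM; apply: ler_wpM2l => //; exact: ltW.
rewrite hgtD hgtN cE ler_norml => /andP[h1 h2].
move: rj; rewrite /w !hgtD !hgtN => rj.
by apply/andP; split; lra.
Unshelve. all: by end_near. Qed.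

Unset Implicit Arguments.

Theorem mainTheorem8 (R : realType) (m : nat) (hm : (4 <= m)%N) :
  exists P : set (plane R),
    [/\ convex_polygon (2 * m)%N P,
        centrally_symmetric P &
        ~ exists2 L : plane R -> nat, discrete_multiset L & multi_tiles P L].
Proof.
have hs := @slope_homo R.
have m1 : (1 < m)%N by apply: leq_trans hm.
exists (zonogon (slope R) m); split.
- exact: zonogon_polygon.
- exact: zonogon_centrally_symmetric.
case=> L _ [k k0 tile].
have {}tile : {ae (@lebesgue_measure R \x @lebesgue_measure R)%E,
     forall x : plane R, coverage (zonogon (slope R) m) L x = (k%:R)%:E} by [].
have [c [r r0 cP]] := zonogon_box hs m1.
have Lloc := coverage_locally_at_most r0 cP tile.
have ray i : (i < m)%N -> forall a, msupport L a -> exists b : bool, forall n,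
    msupport L (a + (if b then ((1, slope R i) : plane R) else cross (slope R) m i) *+ n).
  move=> im; apply: ray_dichotomy => x.
  exact: (rectangle_identity hs x m1 im r0 Lloc tile).
have L0 : msupport L = set0.
  pose u i (b : bool) := if b then ((1, slope R i) : plane R) else cross (slope R) m i.
  apply: (@three_directions R _ r k (u 0%N) (u 1%N) (u 2)) => //.
  - by apply: ray; apply: leq_trans hm.
  - by apply: ray.
  - by apply: ray; apply: leq_trans hm.
  - exact: slope_free.
(* With empty support the coverage is 0, whereas it equals the positive [k] at some point. *)
have [x _] := ae_near_box c r0 tile.
rewrite /coverage L0 esum_set0 => -[] /eqP.
by rewrite eq_sym pnatr_eq0 -leqn0 leqNgt k0.
Qed.
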